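(* Let $G$ be a group, let $n$ be a positive odd integer and let $m>1$ be an integer. Then $\Gamma_G\cong\Gamma_{K}$, where $K=\big(\bigoplus_{i=1}^m\mathbb{Z}_2\big)\oplus\mathbb{Z}_n$, if and only if $G\cong\big(\bigoplus_{i=1}^m\mathbb{Z}_2\big)\oplus\mathbb{Z}_n$.
   Context: A group is locally cyclic if each of its finitely generated subgroups is cyclic. For a group $G$, $Cyc(G)=\{x\in G : \langle x,y\rangle \text{ is cyclic for all } y\in G\}$. For a non locally cyclic group $G$, the non-cyclic graph $\Gamma_G$ is the simple graph with vertex set $G\setminus Cyc(G)$ in which two distinct vertices $x,y$ are adjacent if and only if $\langle x,y\rangle$ is not cyclic. $\Gamma_G\cong\Gamma_K$ means that $G$ and $K$ are non locally cyclic groups and the two graphs are isomorphic ($G$ is not assumed finite). $\mathbb{Z}_n$ is the cyclic group of order $n$. *)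

(* Defs.v *)
From HB Require Import structures.
From mathcomp Require Import all_boot all_algebra all_fingroup.
From mathcomp Require Import boolp classical_sets cardinality.

Set Implicit Arguments.
Unset Strict Implicit.
Unset Printing Implicit Defensive.

Local Open Scope classical_set_scope.
Local Open Scope group_scope.

(* The groups below are of type groupType and may be infinite: the notions of
   the finite group library (<<A>>, <[x]>, cyclic, isog) do not apply.
   groupType includes a choiceType structure, which every type has under the
   axioms of boolp, so this is no restriction on the group. *)

Section Subgroups.
Variable G : groupType.
Implicit Types (x y : G) (A H : set G).

Definition subgroup H : Prop := group_closed [in H].

Definition gen A : set G := smallest subgroup A.

Definition cyclic_subgroup H : Prop := exists x, H = gen [set x].

Definition fg_subgroup H : Prop := exists A, finite_set A /\ H = gen A.

Definition locally_cyclic : Prop := forall H, fg_subgroup H -> cyclic_subgroup H.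

Definition Cyc : set G := [set x | forall y, cyclic_subgroup (gen [set x; y])].

End Subgroups.

Arguments locally_cyclic : clear implicits.
Arguments Cyc : clear implicits.

Record sgraph := SGraph {
  vertex :> Type;
  adj : vertex -> vertex -> Prop;
  adj_sym : forall u v, adj u v -> adj v u;
  adj_irrefl : forall u, ~ adj u u }.

Definition graph_iso (A B : sgraph) : Prop :=
  exists2 f : A -> B, bijective f & forall u v, adj u v <-> adj (f u) (f v).

Section NonCyclicGraph.
Variable G : groupType.

Definition noncyclic_adj (u v : set_type (~` Cyc G)) : Prop :=
  u <> v /\ ~ cyclic_subgroup (gen [set val u; val v]).

Lemma noncyclic_adj_sym u v : noncyclic_adj u v -> noncyclic_adj v u.
Proof. by case=> uv Nuv; split; [exact: nesym | rewrite setUC]. Qed.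

Lemma noncyclic_adj_irrefl u : ~ noncyclic_adj u u.
Proof. by case. Qed.

Definition noncyclic_graph : sgraph :=
  SGraph noncyclic_adj_sym noncyclic_adj_irrefl.

End NonCyclicGraph.

(* The graph of G is only considered when G is not locally cyclic, so an
   isomorphism of non-cyclic graphs includes that condition on both groups. *)
Definition noncyclic_graph_iso (G K : groupType) : Prop :=
  [/\ ~ locally_cyclic G, ~ locally_cyclic K
    & graph_iso (noncyclic_graph G) (noncyclic_graph K)].

Definition group_iso (G K : groupType) : Prop :=
  exists f : {multiplicative G -> K}, bijective f.

(* The additive group of integers mod n, for n > 0. The type 'I_n carries a
   group structure only for n of the form k.+1, and 'Z_n is the group of
   integers mod 2 when n = 1, hence the bound n.-1.+1 (equal to n if n > 0). *)
Definition Zmod (n : nat) : groupType := 'I_n.-1.+1.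

Definition Z2m_Zn (m n : nat) : groupType := ({ffun 'I_m -> Zmod 2} * Zmod n)%type.

(* Main.v *)
(* Two vertices of the graph of K lie in the same part iff their (Z_2)^m
   components agree, so the graph is complete multipartite with N = 2^m - 1
   parts of size n, and so is the graph of G.  As Cyc(G) is a subgroup whose
   complement is finite and nonempty, G is finite.  Let C = Cyc(G), of order c.
   Each part together with C is a cyclic subgroup of order n + c, so n = c k,
   |G| = c (1 + k N), and each part contains exactly one involution.

   Suppose k > 1, and let M be the part of an involution s, together with C.
   An element x outside M that commutes with s has its square in C, since
   otherwise x s, x^2 and x would lie in one part.  Hence x inverts M modulo C,
   which forces the index of M in the centralizer of s to be 1 or 2.  So all
   classes of involutions have sizes divisible by Q = (1 + k N) / 2(k + 1), an
   integer because k is odd and N = 3 mod 4.  Thus Q divides N, the number of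
   involutions, and also 1 + k N; so Q = 1, which is absurd as N > 2.

   Hence k = 1 and |G| = 2^m n.  A Sylow 2-subgroup is elementary abelian,
   because each of its elements lies in a cyclic subgroup of order 2 n, and G is
   its direct product with the central cyclic subgroup C of order n. *)
From HB Require Import structures.
Require Import Defs.
From mathcomp Require Import all_boot all_algebra all_fingroup.
From mathcomp Require Import all_solvable mxabelem zify.

Set Implicit Arguments.
Unset Strict Implicit.
Unset Printing Implicit Defensive.

Local Open Scope group_scope.

(** * Parity of the quotient of 1 + k N by k + 1 *)

(** Write k = 2l + 1 and N = 4r + 3. Halving the equation gives q (l + 1) = 2 + 3l + 2r + 4lr, so q
    (l + 1) has the parity of l, which is impossible for odd q. *)
Lemma even_multipartite_quotient k N q : odd k -> N = 3 %[mod 4] ->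
  (q * k.+1 = 1 + k * N)%N -> ~~ odd q.
Proof.
move=> oddk /eqP; rewrite -[X in _ == X]/(3 + 0) => N3 qE.
have [r Nr] : exists r, N = 4 * r + 3.
  by exists (N %/ 4); rewrite {1}(divn_eq N 4) (eqP N3) mulnC.
move: qE; rewrite -(odd_double_half k) oddk Nr => qE.
have : (q * (k./2).+1 = 2 + 4 * (k./2 * r) + 3 * k./2 + 2 * r)%N.
  apply/eqP; rewrite -(eqn_pmul2r (isT : 0 < 2)) -mulnA; apply/eqP.
  move: qE; rewrite -muln2 => qE.
  rewrite (_ : k./2.+1 * 2 = (1 + k./2 * 2).+1)%N ?qE; nia.
move/(congr1 odd); rewrite oddM !oddD !oddM /= addbF.
by case: (odd q) (odd k./2) (odd r) => [] [] [].
Qed.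

(** * Cyclic pairs in finite groups *)

Section CyclicPairs.
Variable gT : finGroupType.
Implicit Types x y z : gT.

Definition cyc2 x y := cyclic <<[set x; y]>>.

Definition cyclicizer : {set gT} := [set x | [forall y, cyc2 x y]].

(** When the graph is complete multipartite and [x] is a vertex, this is the part of [x] together
    with [cyclicizer]. *)
Definition cyc_nbhd x : {set gT} := [set y | cyc2 x y].

Lemma cyc2P x y :
  reflect (exists z, x \in <[z]> /\ y \in <[z]>) (cyc2 x y).
Proof.
apply: (iffP idP) => [/cyclicP[z eq_z]|[z [xz yz]]].
  by exists z; rewrite -eq_z !mem_gen // !inE eqxx ?orbT.
apply: cyclicS (cycle_cyclic z).
by rewrite gen_subG subUset !sub1set xz.
Qed.

Lemma cyc2C x y : cyc2 x y = cyc2 y x.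
Proof. by rewrite /cyc2 setUC. Qed.

Lemma cyc2xx x : cyc2 x x.
Proof. by apply/cyc2P; exists x; rewrite cycle_id. Qed.

Lemma cyc2X x k : cyc2 x (x ^+ k).
Proof. by apply/cyc2P; exists x; rewrite cycle_id mem_cycle. Qed.

Lemma cyc2M x y : cyc2 x y -> cyc2 x (x * y).
Proof.
by case/cyc2P=> z [xz yz]; apply/cyc2P; exists z; rewrite xz groupM.
Qed.

Lemma cyc2_commute x y : cyc2 x y -> commute x y.
Proof.
case/cyc2P=> z [/cycleP[i ->] /cycleP[j ->]].
exact: commuteX2.
Qed.

(** A cyclic group has at most one subgroup of order 2. Hence no part contains two involutions. *)
Lemma cyc2_involutions x y : cyc2 x y -> #[x] = 2 -> #[y] = 2 -> x = y.
Proof.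
case/cyc2P=> z [xz yz] ox oy.
have: <[x]> == <[y]>.
  rewrite (eq_subG_cyclic (cycle_cyclic z)) ?cycle_subG //.
  by rewrite -!orderE ox oy.
move/eqP=> eqxy; have := cycle_id x; rewrite eqxy cycle2g //.
by rewrite !inE => /orP[/eqP x1|/eqP //]; move: ox; rewrite x1 order1.
Qed.

(** An element [g] of maximal order generates: for [y] in [H], a generator of the subgroup generated
    by [g] and [y] cannot have larger order than [g]. *)
Lemma pairwise_cyclic (H : {group gT}) : {in H &, forall x y, cyc2 x y} -> cyclic H.
Proof.
move=> cH; have [g Hg max_g]: exists2 g, g \in H & forall y, y \in H -> #[y] <= #[g].
  have := arg_maxnP (fun x => #[x]) (group1 H : [in H] 1).
  by case=> g Hg max_g; exists g.
apply/cyclicP; exists g; apply/eqP; rewrite eqEsubset cycle_subG Hg andbT.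
apply/subsetP=> y Hy; have /cyclicP[z eq_z] := cH g y Hg Hy.
have gz: g \in <[z]> by rewrite -eq_z mem_gen // !inE eqxx.
have yz: y \in <[z]> by rewrite -eq_z mem_gen // !inE eqxx orbT.
have Hz: z \in H.
  rewrite -cycle_subG -eq_z gen_subG; apply/subsetP=> u.
  by rewrite !inE => /orP[] /eqP->.
have: <[g]> == <[z]>.
  by rewrite eqEcard cycle_subG gz /= -!orderE max_g.
by move/eqP->.
Qed.

Lemma cyclicizerP x : reflect (forall y, cyc2 x y) (x \in cyclicizer).
Proof. by rewrite inE; apply: forallP. Qed.

(** Common generators are found twice: [t] for [y] and [z], then [u] for [x] and [t]. *)
Lemma cyclicizer_group_set : group_set cyclicizer.
Proof.
apply/group_setP; split=> [|x y /cyclicizerP Cx /cyclicizerP Cy].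
  by apply/cyclicizerP=> y; apply/cyc2P; exists y; rewrite group1 cycle_id.
apply/cyclicizerP=> z; have /cyc2P[t [yt zt]] := Cy z.
have /cyc2P[u [xu tu]] := Cx t; apply/cyc2P; exists u.
have sub : <[t]> \subset <[u]> by rewrite cycle_subG.
by rewrite groupM ?(subsetP sub z zt) ?(subsetP sub y yt).
Qed.

Canonical cyclicizer_group := Group cyclicizer_group_set.

Lemma cyclicizer_commute x y : x \in cyclicizer -> commute x y.
Proof. by move/cyclicizerP/(_ y)/cyc2_commute. Qed.

Lemma sub_cyc_nbhd x : cyclicizer \subset cyc_nbhd x.
Proof. by apply/subsetP=> y /cyclicizerP/(_ x); rewrite inE cyc2C. Qed.

Lemma cyclicizer_cyclic : cyclic cyclicizer.
Proof. by apply: pairwise_cyclic => x y /cyclicizerP Cx _. Qed.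

End CyclicPairs.

(** * Coordinates on elementary abelian 2-groups *)

Lemma abelem2_ffun (gT : finGroupType) (S : {group gT}) m : 0 < m ->
    2.-abelem S -> #|S| = (2 ^ m)%N ->
  exists phi : {ffun 'I_m -> 'I_2} -> gT, [/\ {morph phi : x y / x * y},
    injective phi & forall v, phi v \in S].
Proof.
move=> m_gt0 abS oS.
have ntS : S :!=: 1 by rewrite -cardG_gt1 oS (ltn_exp2l 0 m (isT : 1 < 2)).
have dimS : (abelem_dim' S).+1 = m.
  by rewrite /abelem_dim' oS -(prednK m_gt0) pdiv_pfactor // pfactorK.
pose row (v : {ffun 'I_m -> 'I_2}) : 'rV['F_2]_((abelem_dim' S).+1) :=
  (\row_j v (cast_ord dimS j))%R.
exists (fun v => rVabelem abS ntS (row v)); split=> [v w|v w|v].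
- rewrite (_ : row (v * w) = (row v + row w)%R).
    exact: rVabelemD.
  by apply/rowP=> j; rewrite !mxE ffunE.
- move/rVabelem_inj/rowP=> eq_vw; apply/ffunP=> j.
  by have := eq_vw (cast_ord (esym dimS) j); rewrite !mxE cast_ordKV.
exact: mem_rVabelem.
Qed.

(** * Finite groups with a complete multipartite non-cyclic graph *)

Section Multipartite.
Variables (gT : finGroupType) (T : finType) (t0 : T) (col : gT -> T).
Variables (n m : nat).
Local Notation C := (cyclicizer gT).
Local Notation M := (@cyc_nbhd gT).
Local Notation c := #|C|.
Implicit Types x y z s g : gT.

(* [col] names the part of a vertex of the non-cyclic graph; the value [t0]
   marks the elements that are not vertices. *)
Hypothesis colC : forall x, (col x == t0) = (x \in C).
Hypothesis colE : forall x y, x \notin C -> y \notin C -> cyc2 x y = (col x == col y).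
Hypothesis col_card : forall t, t != t0 -> #|[set x | col x == t]| = n.
Hypothesis oddn : odd n.
Hypothesis m_gt1 : 1 < m.
Hypothesis cardT : #|T| = (2 ^ m)%N.

Let n_gt0 : 0 < n. Proof. by case: n oddn. Qed.

(** * The parts as subgroups, and their sizes *)

Lemma cyc2_trans y x z : y \notin C -> cyc2 x y -> cyc2 y z -> cyc2 x z.
Proof.
move=> nCy xy yz; have [/cyclicizerP-> //|nCx] := boolP (x \in C).
have [/cyclicizerP Cz|nCz] := boolP (z \in C); first by rewrite cyc2C.
by move: xy yz; rewrite !colE // => /eqP->.
Qed.

(** If one factor lies outside [C], it links the product to [x] by transitivity; if both lie in [C],
    so does the product. *)
Lemma cyc_nbhd_group_set x : x \notin C -> group_set (M x).
Proof.
move=> nCx; apply/group_setP; split.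
  by rewrite (subsetP (sub_cyc_nbhd x)) ?group1.
move=> y z; rewrite !inE => xy xz.
have yz : cyc2 y z by apply: cyc2_trans xz; rewrite // cyc2C.
have yzC : y * z = z * y := cyc2_commute yz.
have [Cy|nCy] := boolP (y \in C); last exact: cyc2_trans (cyc2M yz).
have [Cz|nCz] := boolP (z \in C).
  by have:= subsetP (sub_cyc_nbhd x) _ (groupM Cy Cz); rewrite inE.
by rewrite yzC; apply: (cyc2_trans nCz) => //; apply: cyc2M; rewrite cyc2C.
Qed.

Lemma card_cyc_nbhd x : x \notin C -> #|M x| = c + n.
Proof.
move=> nCx; have ->: M x = C :|: [set y | col y == col x].
  apply/setP=> y; rewrite !inE; have [Cy|nCy] := boolP (y \in C).
    by rewrite cyc2C (cyclicizerP _ Cy); move: Cy; rewrite inE => ->.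
  by move: (nCy); rewrite inE => /negbTE-> /=; rewrite colE // eq_sym.
rewrite cardsU (_ : _ :&: _ = set0) ?cards0 ?subn0 ?col_card ?colC //.
apply/setP=> y; rewrite inE in_set0; apply/andP=> -[Cy]; rewrite inE => /eqP.
by move=> eqxy; case/negP: nCx; rewrite -colC -eqxy colC.
Qed.

Lemma card_multipartite : #|[set: gT]| = c + n * (2 ^ m).-1.
Proof.
rewrite cardsT -(cardsC C) -cardT; congr (_ + _).
rewrite -sum1_card (partition_big col (predC1 t0)) /=; last first.
  by move=> x; rewrite inE -colC.
rewrite (eq_bigr (fun=> n)) => [|t t_neq].
  by rewrite sum_nat_const cardC1 mulnC.
rewrite -(col_card t_neq) -sum1_card; apply: eq_bigl => x.
rewrite in_setC -colC [in RHS]inE.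
by case: (col x =P t) => [->|_]; rewrite ?andbF ?andbT.
Qed.

Lemma multipartite_vertex : exists x, x \notin C.
Proof.
apply/existsP; apply: contraT; rewrite negb_exists => /forallP CT.
have eqC : C = [set: gT] by apply/setP=> x; rewrite in_setT; apply: negbNE (CT x).
have := card_multipartite; rewrite -eqC => /eqP.
rewrite -[X in X == _]addn0 eqn_add2l eq_sym muln_eq0.
have := ltn_exp2l 1 m (isT : 1 < 2); rewrite expn1; lia.
Qed.

(** By Lagrange, c divides the order c + n of the subgroup [M x]. *)
Lemma dvdn_card_cyclicizer : c %| n.
Proof.
have [x nCx] := multipartite_vertex.
have := cardSg (sub_cyc_nbhd x : C \subset Group (cyc_nbhd_group_set nCx)).
by rewrite /= card_cyc_nbhd // dvdn_addr.
Qed.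

Let k := n %/ c.
Let nE : n = (c * k)%N. Proof. by rewrite mulnC divnK ?dvdn_card_cyclicizer. Qed.
Let oddc : odd c. Proof. by move: oddn; rewrite nE oddM => /andP[]. Qed.
Let oddk : odd k. Proof. by move: oddn; rewrite nE oddM => /andP[]. Qed.
Let N := (2 ^ m).-1.

(** * Involutions and their centralizers *)

Lemma involution_notin_cyclicizer s : #[s] = 2 -> s \notin C.
Proof.
move=> os; apply: contraL oddc => Cs; rewrite -dvdn2 -os.
exact: order_dvdG.
Qed.

Let I := [set s : gT | #[s] == 2].

(** [col] maps the involutions bijectively onto the colours other than [t0]; surjectivity is
    Cauchy's theorem in [M x], whose order c + n is even. *)
Lemma card_involutions : #|I| = N.
Proof.
rewrite /N -cardT -(cardC1 t0) -(@card_in_imset _ _ col I); last first.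
  move=> s t; rewrite !inE => /eqP os /eqP ot eq_st.
  apply: cyc2_involutions => //.
  by rewrite colE ?eq_st ?involution_notin_cyclicizer.
apply: eq_card => t; rewrite !inE; apply/imsetP/idP.
  case=> s; rewrite inE => /eqP os ->.
  by rewrite colC; apply: involution_notin_cyclicizer.
move=> t_neq; have: 0 < #|[set x | col x == t]| by rewrite col_card.
case/card_gt0P=> x; rewrite inE => /eqP col_x.
have nCx: x \notin C by rewrite -colC col_x.
have: 2 %| #|Group (cyc_nbhd_group_set nCx)|.
  by rewrite /= card_cyc_nbhd // dvdn2 oddD oddc oddn.
case/Cauchy=> // s; rewrite inE => xs os.
exists s; rewrite ?inE ?os // -col_x; apply/eqP.
by rewrite -colE // involution_notin_cyclicizer.
Qed.

(* Otherwise [x * s], [x ^+ 2 = (x * s) ^+ 2] and [x] all lie in one part. *)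
Lemma cent_involution_sqr s x :
  #[s] = 2 -> commute x s -> x \notin M s -> x ^+ 2 \in C.
Proof.
move=> os xs nMx; apply: contraR nMx => nCx2.
have s2 : s ^+ 2 = 1 by apply/eqP; rewrite -order_dvdn os.
have xs2 : (x * s) ^+ 2 = x ^+ 2 by rewrite expgMn // s2 mulg1.
have : cyc2 (x * s) x.
  apply: (cyc2_trans nCx2); first by rewrite -xs2 cyc2X.
  by rewrite cyc2C cyc2X.
case/cyc2P=> z [xsz xz]; rewrite inE; apply/cyc2P; exists z; split=> //.
by rewrite -(groupMl s xz).
Qed.

Lemma sub_cyc_nbhd_cent s : M s \subset 'C[s].
Proof. by apply/subsetP=> x; rewrite inE => /cyc2_commute sx; apply/cent1P. Qed.

(** The order of [g] is c (k + 1) > 2c, whereas [g ^+ 2] in [C] would bound it by 2c. *)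
Lemma cyc_nbhd_sqr s g : 1 < k -> s \notin C -> M s = <[g]> -> g ^+ 2 \notin C.
Proof.
move=> k_gt1 nCs eqM; apply/negP=> Cg2.
have og : #[g] = (c * k.+1)%N by rewrite orderE -eqM card_cyc_nbhd // nE mulnS.
have : #[g ^+ 2] <= c by rewrite dvdn_leq ?cardG_gt0 ?order_dvdG.
have: #[g] <= #[g ^+ 2] * 2.
  rewrite orderXgcd; rewrite -{1}(divnK (dvdn_gcdl #[g] 2)).
  by rewrite leq_mul2l (@dvdn_leq _ 2) ?orbT ?dvdn_gcdr.
have c_gt0 : 0 < c := cardG_gt0 _.
rewrite og => le1 le2; have := leq_trans le1 (leq_mul le2 (leqnn 2)).
by rewrite leq_pmul2l // ltnS leqNgt k_gt1.
Qed.

(* Outside [M s], the centralizer of [s] inverts [M s] modulo [C], and a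
   product of two inversions of [M s] is not an inversion if [1 < k]. *)
Lemma cent_involution_mul s x y : 1 < k -> #[s] = 2 -> x \in 'C[s] :\: M s ->
  y \in 'C[s] :\: M s -> x * y \in M s.
Proof.
move=> k_gt1 os; have nCs := involution_notin_cyclicizer os.
have cMs : cyclic (Group (cyc_nbhd_group_set nCs)).
  by apply: pairwise_cyclic => u v /=; rewrite !inE cyc2C; apply: cyc2_trans.
have /cyclicP[g /= eqM] := cMs.
have nCg2 := cyc_nbhd_sqr k_gt1 nCs eqM.
have Mg : g \in M s by rewrite eqM cycle_id.
(* Both [w] and [w * g] commute with [s] and avoid [M s], so their squares lie in [C]; the witness
   comes from (w g)^2 = w^2 g^w g. *)
have inv w : w \in 'C[s] :\: M s -> exists2 z, z \in C & g ^ w = g^-1 * z.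
  rewrite in_setD => /andP[nMw Cw].
  have ws : commute w s by apply/cent1P.
  have nMgw : w * g \notin M s.
    by move: nMw Mg; rewrite eqM => nMw Mg; rewrite groupMr.
  have Cw2 := cent_involution_sqr os ws nMw.
  have wgs : commute (w * g) s.
    by apply/cent1P; rewrite groupM // (subsetP (sub_cyc_nbhd_cent s)).
  have Cwg2 := cent_involution_sqr os wgs nMgw.
  have Cz : w ^- 2 * (w * g) ^+ 2 \in C by rewrite groupM ?groupV.
  exists (w ^- 2 * (w * g) ^+ 2) => //.
  by rewrite -(cyclicizer_commute g^-1 Cz) conjgE !expgS !expg0 !gnorm.
move=> Dx Dy; apply: contraR nCg2 => nMxy.
have [z1 Cz1 gx] := inv x Dx; have [z2 Cz2 gy] := inv y Dy.
have [z3 Cz3] : exists2 z, z \in C & g ^ (x * y) = g^-1 * z.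
  apply: inv; rewrite in_setD nMxy groupM //.
    by case/setDP: Dx.
  by case/setDP: Dy.
have z1y : z1 ^ y = z1 by rewrite conjgE (cyclicizer_commute y Cz1) mulKg.
rewrite conjgM gx conjMg conjVg gy z1y => gz3.
have -> : g ^+ 2 = z3 * z1^-1 * z2.
  rewrite -(mulKVg g z3) -gz3 invMg invgK !mulgA mulgK.
  by rewrite -(mulgA g) (cyclicizer_commute g (groupVr Cz2)) !gnorm.
by rewrite !groupM ?groupV.
Qed.

(** If [x] centralizes [s] outside [M s], every other such [y] has [x * y] in [M s], so two cosets
    of [M s] cover the centralizer. *)
Lemma card_cent_involution s : 1 < k -> #[s] = 2 -> #|'C[s]| %| 2 * #|M s|.
Proof.
move=> k_gt1 os; have nCs := involution_notin_cyclicizer os.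
pose Ms := Group (cyc_nbhd_group_set nCs).
have sMC : Ms \subset 'C[s] := sub_cyc_nbhd_cent s.
rewrite -(Lagrange sMC) mulnC dvdn_pmul2r ?cardG_gt0 //.
suff: #|'C[s] : Ms| <= 2 by case: #|_ : _| (indexg_gt0 'C[s] Ms) => [|[|[|]]].
have [sCM|] := boolP ('C[s] \subset Ms).
  by move: sCM; rewrite -indexg_eq1 => /eqP->.
case/subsetPn=> x Cx nMx; rewrite -(leq_pmul2l (cardG_gt0 Ms)) Lagrange //.
have sub : 'C[s] \subset Ms :|: x^-1 *: Ms.
  apply/subsetP=> y Cy; rewrite inE; have [//|nMy] := boolP (y \in Ms).
  by rewrite mem_lcoset invgK; apply: cent_involution_mul (os) _ _ => //; apply/setDP.
rewrite (leq_trans (subset_leq_card sub)) // (leq_trans (leq_card_setU _ _)) //.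
by rewrite card_lcoset muln2 addnn.
Qed.

(* The sizes of the classes of involutions are multiples of
   [Q = (1 + k * N) / (2 * k.+1)], hence so is their sum [N]. *)
Lemma multipartite_quotient_eq1 : k = 1%N.
Proof.
have k_gt0 : 0 < k by case: k oddk.
apply/eqP; rewrite eqn_leq k_gt0 andbT leqNgt; apply/negP=> k_gt1.
have [x nCx] := multipartite_vertex.
have dvd_k1 : k.+1 %| 1 + k * N.
  have := cardSg (subsetT (Group (cyc_nbhd_group_set nCx))).
  rewrite /= card_cyc_nbhd // card_multipartite nE -mulnS -mulnA.
  by rewrite -mulnS dvdn_pmul2l ?cardG_gt0.
have N3 : N = 3 %[mod 4].
  rewrite /N -(subnKC m_gt1) expnD -[(2 ^ 2)%N]/4.
  have := expn_gt0 2 (m - 2); case: (2 ^ (m - 2))%N => // p _.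
  by rewrite (_ : (4 * p.+1).-1 = p * 4 + 3)%N ?modnMDl //; lia.
have [Q QE] : exists Q, (1 + k * N = Q * (2 * k.+1))%N.
  have [q qE] := dvdnP dvd_k1; exists q./2.
  by rewrite qE mulnA muln2 even_halfK ?(even_multipartite_quotient oddk N3).
(* The group has order Q * 2 |M s|, and the centralizer order divides 2 |M s|; the cofactor [e]
   gives a class of size e Q. *)
have dvdQ s : s \in I -> Q %| #|s ^: [set: gT]|.
  rewrite inE => /eqP os; have [e eE] := dvdnP (card_cent_involution k_gt1 os).
  apply/dvdnP; exists e; apply/eqP; rewrite -(eqn_pmul2l (cardG_gt0 'C[s])).
  rewrite -index_cent1 setTI Lagrange ?subsetT // card_multipartite -/N.
  have -> : (c + n * N = Q * (2 * #|M s|))%N.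
    rewrite card_cyc_nbhd ?involution_notin_cyclicizer // nE -mulnS -mulnA -mulnS.
    by rewrite -add1n QE mulnCA (mulnCA c 2).
  by rewrite eE mulnA mulnC (mulnC e).
have dvdQN : Q %| N.
  rewrite -card_involutions -(@acts_sum_card_orbit _ _ _ 'J [set: gT]).
    by apply: dvdn_sum => O /imsetP[s Is ->]; apply: dvdQ.
  apply/subsetP=> g _; rewrite !inE /=; apply/subsetP=> s.
  by rewrite !inE /= orderJ.
have : Q %| 1.
  by rewrite -(dvdn_addl _ (dvdn_mull k dvdQN)) QE dvdn_mulr.
(* With Q = 1 the identity reads 1 + k N = 2k + 2, while N >= 3 forces k <= 1. *)
rewrite dvdn1 => /eqP Q1; move: QE; rewrite Q1 mul1n => kN.
have N_gt2 : 2 < N.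
  by rewrite /N -ltnS prednK ?expn_gt0 // (leq_exp2l 2 m (isT : 1 < 2)).
have : 1 + k * 3 <= 2 * k.+1 by rewrite -kN leq_add2l leq_mul2l N_gt2 orbT.
by rewrite (mulnS k 2) (mulnS 2 k) addnA (mulnC k 2) leq_add2r ltnS leqNgt k_gt1.
Qed.

(** * Direct decomposition and parametrization of the group *)

Let cE : c = n. Proof. by rewrite [RHS]nE multipartite_quotient_eq1 muln1. Qed.

Lemma multipartite_structure :
  exists S : {group gT},
    [/\ 2.-abelem S, #|S| = (2 ^ m)%N, #|C| = n & S \x C = [set: gT]].
Proof.
have [S sylS] := Sylow_exists 2 [set: gT]; exists S.
have oG : #|[set: gT]| = (2 ^ m * n)%N.
  by rewrite card_multipartite cE -mulnS prednK ?expn_gt0 // mulnC.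
have oS : #|S| = (2 ^ m)%N.
  rewrite (card_Hall sylS) oG partnM ?expn_gt0 // part_pnat_id ?pnatX ?pnat_id //.
  by rewrite [(n`_2)%N]part_p'nat ?muln1 // p'natE // dvdn2 oddn.
have coSC : coprime #|S| #|C| by rewrite oS cE coprimeXl // coprime2n.
split=> //.
  apply/exponent2_abelem/exponentP=> x Sx; apply/eqP.
  have [Cx|nCx] := boolP (x \in C).
    have : x \in S :&: C by rewrite inE Sx.
    by rewrite coprime_TIg // => /set1P->; rewrite expg1n.
  rewrite -order_dvdn; have : #[x] %| 2 * n.
    have xM : x \in Group (cyc_nbhd_group_set nCx) by rewrite /= inE cyc2xx.
    by have := order_dvdG xM; rewrite /= card_cyc_nbhd // cE mul2n addnn.
  rewrite Gauss_dvdl //; have := order_dvdG Sx; rewrite oS => ox.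
  by apply: coprime_dvdl ox _; rewrite coprimeXl // coprime2n.
have cSC : C \subset 'C(S).
  by apply/centsP=> x Cx y _; apply: cyclicizer_commute.
rewrite dprodE ?coprime_TIg //; apply/eqP; rewrite eqEcard subsetT /= oG.
by rewrite coprime_cardMg // oS cE.
Qed.

(** [S] supplies the (Z_2)^m coordinates and a generator [z] of the central subgroup [C] the Z_n
    coordinate. As [S] and [C] meet trivially, the product map is injective, and a count of elements
    makes it bijective. *)
Lemma multipartite_param :
  exists2 g : {ffun 'I_m -> 'I_2} * 'I_n.-1.+1 -> gT,
    {morph g : x y / x * y} & bijective g.
Proof.
have [S [abS oS oC defG]] := multipartite_structure.
have [|phi [phiM phi_inj phiS]] := abelem2_ffun _ abS oS; first exact: ltnW.
have /cyclicP[z eqC] := cyclicizer_cyclic gT.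
have Cz : z \in C by rewrite eqC cycle_id.
have oz : #[z] = n by rewrite orderE -eqC.
have n1 : n.-1.+1 = n by rewrite prednK.
have [_ _ _ tiSC] := dprodP defG.
have zM (i j : 'I_n.-1.+1) : z ^+ val (i * j) = z ^+ i * z ^+ j.
  rewrite -expgnDr; apply/eqP; rewrite eq_expg_mod_order oz.
  have -> : val (i * j) = (i + j) %% n by rewrite -[X in _ = _ %% X]n1.
  by rewrite modn_mod.
pose g (u : {ffun 'I_m -> 'I_2} * 'I_n.-1.+1) := phi u.1 * z ^+ u.2.
exists g => [[v i] [w j]|]; rewrite /g.
  rewrite /= phiM zM !mulgA; congr (_ * _); rewrite -!mulgA; congr (_ * _).
  exact/commute_sym/cyclicizer_commute/groupX.
apply: inj_card_bij => [[v i] [w j] /= eq_vw|]; last first.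
  by rewrite card_prod card_ffun !card_ord n1 -oC -oS (dprod_card defG) cardsT.
have S1 : (phi w)^-1 * phi v \in S :&: C.
  rewrite inE groupM ?groupV //=.
  rewrite (_ : _ * _ = z ^+ j * (z ^+ i)^-1) ?groupM ?groupV ?groupX //.
  by apply: (mulIg (z ^+ i)); rewrite -mulgA eq_vw mulKg mulgVK.
move: S1; rewrite tiSC => /set1P /(canRL (mulKVg _)); rewrite mulg1 => /phi_inj eqvw.
move: eq_vw; rewrite eqvw => /mulgI /eqP; rewrite eq_expg_mod_order oz.
have lt_n (l : 'I_n.-1.+1) : l < n by rewrite -[X in _ < X]n1.
by rewrite !modn_small // => /eqP eqij; congr (_, _); apply: val_inj.
Qed.

End Multipartite.

(** * Cyclic subgroups of arbitrary groups *)

From mathcomp Require Import boolp classical_sets cardinality.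
Local Open Scope classical_set_scope.

Section CyclicSubgroups.
Variable G : groupType.
Implicit Types (x y z : G) (A H : set G).

Lemma subgroupP H : subgroup H <-> H 1 /\ forall x y, H x -> H y -> H (x * y^-1).
Proof.
split=> [[]|[H1 HF]].
  rewrite !inE => H1 HF; split=> // x y Hx Hy.
  by have := HF x y; rewrite !inE; apply.
by split=> [|x y]; rewrite !inE //; apply: HF.
Qed.

Lemma subgroup1 H : subgroup H -> H 1.
Proof. by case/subgroupP. Qed.

Lemma subgroupV H x : subgroup H -> H x -> H x^-1.
Proof. by case/subgroupP=> H1 HF Hx; rewrite -[x^-1]mul1g; apply: HF. Qed.

Lemma subgroupM H x y : subgroup H -> H x -> H y -> H (x * y).
Proof.
move=> sH Hx Hy; rewrite -[y]invgK; case/subgroupP: (sH) => _; apply=> //.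
exact: subgroupV.
Qed.

Lemma subgroupX H x i : subgroup H -> H x -> H (x ^+ i).
Proof.
move=> sH Hx; elim: i => [|i IHi]; first by rewrite expg0; apply: subgroup1.
by rewrite expgS; apply: subgroupM.
Qed.

Lemma gen_subgroup A : subgroup (gen A).
Proof.
apply/subgroupP; split=> [H [/subgroupP[] //]|x y Ax Ay H [sH sAH]].
by have [_] := (subgroupP H).1 sH; apply; [apply: Ax | apply: Ay].
Qed.

Lemma subset_gen A : A `<=` gen A.
Proof. exact: sub_smallest. Qed.

Lemma gen_subset A H : subgroup H -> A `<=` H -> gen A `<=` H.
Proof. by move=> sH sAH x; apply. Qed.

(** The pair of natural exponents stands for the integer i - j. *)
Lemma gen1P z x : gen [set z] x <-> exists i j, x = z ^+ i * (z ^+ j)^-1.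
Proof.
split=> [gx|[i [j ->]]]; last first.
  have gz : gen [set z] z by apply: subset_gen.
  have sz := gen_subgroup [set z].
  by apply: (subgroupM sz); last apply: (subgroupV sz); apply: (subgroupX _ sz).
apply: (@gen_subset [set z] [set x | exists i j, x = z ^+ i * (z ^+ j)^-1]) gx;
  last first.
  by move=> _ ->; exists 1%N, 0; rewrite expg0 expg1 invg1 mulg1.
apply/subgroupP; split=> /= [|_ _ [i [j ->]] [k [l ->]]].
  by exists 0, 0; rewrite expg0 mulgV.
exists (i + l)%N, (k + j)%N; rewrite !expgnDr !invMg invgK !mulgA.
congr (_ * _); rewrite -!mulgA; congr (_ * _).
by apply/commute_sym/commuteV/commuteX2.
Qed.

(* A generator is the least positive power of [z] in [H]. *)
Lemma subgroup_gen1 H z : subgroup H -> H `<=` gen [set z] -> cyclic_subgroup H.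
Proof.
move=> sH sHz.
have pow x : H x -> exists i, H (z ^+ i) /\ (x = z ^+ i \/ x = (z ^+ i)^-1).
  move=> Hx; have [i [j xE]] := (gen1P z x).1 (sHz x Hx).
  have [le_ji|/ltnW le_ij] := leqP j i.
    by exists (i - j)%N; rewrite expgnFr // -xE; split; [|left].
  exists (j - i)%N; rewrite expgnFr // (_ : _ * _^-1 = x^-1).
    by split; [apply: (subgroupV sH) | right; rewrite invgK].
  by rewrite xE invMg invgK.
pose P i := (0 < i) && `[< H (z ^+ i) >].
(* Without a positive power of [z] in [H], the subgroup [H] is trivial. *)
have [exP|noP] := pselect (exists i, P i); last first.
  have z1 i : H (z ^+ i) -> z ^+ i = 1.
    case: i => [|i] Hi; first by rewrite expg0.
    by case: noP; exists i.+1; rewrite /P /=; apply/asboolP.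
  exists 1; apply/seteqP; split=> [x Hx|].
    have [i [Hi xE]] := pow x Hx; rewrite z1 // invg1 in xE.
    by case: xE => ->; apply: (subgroup1 (gen_subgroup _)).
  by apply: gen_subset => // _ ->; apply: (subgroup1 sH).
have [d /andP[d_gt0 /asboolP Hd] min_d] := ex_minnP exP.
exists (z ^+ d); apply/seteqP; split=> [x Hx|]; last first.
  by apply: gen_subset => // _ ->.
have [i [Hi xE]] := pow x Hx.
have gi : gen [set z ^+ d] (z ^+ i).
  have gd : gen [set z ^+ d] (z ^+ d) by apply: subset_gen.
  (* The remainder of [i] modulo [d] is again the exponent of a power in [H], so minimality of [d]
     makes it 0. *)
  suff i0 : i %% d = 0.
    rewrite (divn_eq i d) i0 addn0 mulnC expgnA.
    by apply: (subgroupX _ (gen_subgroup _)).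
  apply/eqP; apply: contraTT (ltn_pmod i d_gt0) => i_neq0; rewrite -leqNgt.
  apply: min_d; rewrite /P lt0n i_neq0; apply/asboolP.
  have -> : z ^+ (i %% d) = (z ^+ d ^+ (i %/ d))^-1 * z ^+ i.
    by rewrite {3}(divn_eq i d) expgnDr mulnC expgnA mulKg.
  by apply: (subgroupM sH) => //; apply: (subgroupV sH); apply: (subgroupX _ sH).
by case: xE => -> //; apply: (subgroupV (gen_subgroup _)).
Qed.

(** The converse holds because subgroups of cyclic groups are cyclic. *)
Lemma cyclic_pairP x y : cyclic_subgroup (gen [set x; y]) <->
  exists z, gen [set z] x /\ gen [set z] y.
Proof.
split=> [[z genE]|[z [zx zy]]].
  by exists z; rewrite -genE; split; apply: subset_gen; [left|right].
apply: (@subgroup_gen1 _ z); first exact: gen_subgroup.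
by apply: gen_subset; [apply: gen_subgroup | move=> _ [] ->].
Qed.

Lemma cyclic_pairxx x : cyclic_subgroup (gen [set x; x]).
Proof. by apply/cyclic_pairP; exists x; split; apply: subset_gen. Qed.

Lemma Cyc_subgroup : subgroup (Cyc G).
Proof.
apply/subgroupP; split=> [y|x y Cx Cy z].
  apply/cyclic_pairP; exists y; split; last exact: subset_gen.
  exact: (subgroup1 (gen_subgroup _)).
have /cyclic_pairP[t [ty tz]] := Cy z; have /cyclic_pairP[u [ux ut]] := Cx t.
have sub : gen [set t] `<=` gen [set u].
  by apply: gen_subset; [apply: gen_subgroup | move=> _ ->].
apply/cyclic_pairP; exists u; split; last exact: sub.
have sU := gen_subgroup [set u].
by apply: (subgroupM sU) => //; apply: (subgroupV sU); apply: sub.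
Qed.

Lemma not_Cyc_not_locally_cyclic x : ~ Cyc G x -> ~ locally_cyclic G.
Proof.
by move=> nCx lcG; apply: nCx => y; apply: lcG; exists [set x; y].
Qed.

(* A coset of [Cyc G] other than [Cyc G] itself lies in the complement. *)
Lemma finite_group_of_vertices a :
  ~ Cyc G a -> finite_set (~` Cyc G) -> finite_set [set: G].
Proof.
move=> nCa fin; rewrite -(setUv (Cyc G)) finite_setU; split=> //.
apply: (@sub_finite_set _ _ [set a^-1 * y | y in ~` Cyc G]).
  move=> x Cx; exists (a * x); last by rewrite mulKg.
  move=> Cax; apply: nCa; rewrite -[a](mulgK x).
  have sC := Cyc_subgroup; apply: (subgroupM sC) => //; exact: (subgroupV sC).
exact: finite_image.
Qed.

End CyclicSubgroups.

(** * Transport along homomorphisms *)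

Definition multiplicative_of_morph (G K : groupType) (g : K -> G)
    (gM : {morph g : x y / x * y}) : {multiplicative K -> G} :=
  HB.pack_for {multiplicative K -> G} g (isMultiplicative.Build K G g gM).

Lemma multiplicative_cyclic_pair (G K : groupType) (f : {multiplicative G -> K}) x y :
  cyclic_subgroup (gen [set x; y]) -> cyclic_subgroup (gen [set f x; f y]).
Proof.
have f1 : f 1 = 1 by apply: (mulgI (f 1)); rewrite -gmulfM !mulg1.
have fX z i : f (z ^+ i) = f z ^+ i.
  by elim: i => [|i IHi]; rewrite ?expg0 // !expgS gmulfM IHi.
have fV z : f z^-1 = (f z)^-1.
  by apply: (mulgI (f z)); rewrite -gmulfM !mulgV.
have img z u : gen [set z] u -> gen [set f z] (f u).
  by move/gen1P=> [i [j ->]]; apply/gen1P; exists i, j; rewrite gmulfM fV !fX.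
move/cyclic_pairP=> [z [zx zy]]; apply/cyclic_pairP; exists (f z).
by split; apply: img.
Qed.

Lemma group_iso_sym (G K : groupType) : group_iso G K -> group_iso K G.
Proof.
case=> f [g fK gK]; have gM := can2_gmulfM fK gK.
by exists (multiplicative_of_morph gM); exists f.
Qed.

(** * The group [Z2m_Zn] and its graph *)

Section TwoTorsionByCyclic.
Variables (m n : nat).
Hypotheses (oddn : odd n) (m_gt1 : 1 < m).
Let K := Z2m_Zn m n.
Implicit Types (v w : {ffun 'I_m -> 'I_2}) (x y z : K).

Lemma Zmod2_mulgg (i : Zmod 2) : i * i = 1.
Proof. by apply/val_inj; case: i => [[|[|]]]. Qed.

Lemma mulg_ffun2 (v : {ffun 'I_m -> Zmod 2}) : v * v = 1.
Proof. by apply/ffunP=> j; rewrite !ffunE Zmod2_mulgg. Qed.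

(** The first factor has exponent 2, so a power of [z] has first component 1 or [z.1]. Conversely,
    since n is odd, each [v] generates with Z_n a cyclic group. *)
Lemma cyclic_pair_Z2m_Zn x y : cyclic_subgroup (gen [set x; y]) <->
  [\/ x.1 = 1, y.1 = 1 | x.1 = y.1].
Proof.
split.
  have pow z u : gen [set z] u -> u.1 = 1 \/ u.1 = z.1.
    have expz i : (z ^+ i).1 = 1 \/ (z ^+ i).1 = z.1.
      elim: i => [|i]; first by rewrite expg0; left.
      rewrite expgS; case=> /= ->; first by rewrite mulg1; right.
      by rewrite mulg_ffun2; left.
    move/gen1P=> [i [j ->]] /=.
    have inv v : v = 1 \/ v = z.1 -> v^-1 = 1 \/ v^-1 = z.1.
      have -> : v^-1 = v by apply: (mulgI v); rewrite mulgV mulg_ffun2.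
      by [].
    have [->|->] := expz i; have [->|->] := inv _ (expz j).
    - by rewrite mulg1; left.
    - by rewrite mul1g; right.
    - by rewrite mulg1; right.
    - by rewrite mulg_ffun2; left.
  move/cyclic_pairP=> [z [/pow zx /pow zy]].
  case: zx => [|xz]; first by constructor 1.
  case: zy => [|yz]; first by constructor 2.
  by constructor 3; rewrite xz yz.
have pow v (i : Zmod n) b :
    exists k, ((v, inZp 1) : K) ^+ k = (if b then v else 1, i).
  have n_gt0 : 0 < n by case: n oddn.
  have powk k : ((v, inZp 1) : K) ^+ k = (v ^+ odd k, inZp k).
    elim: k => [|k IHk]; first by congr (_, _); apply: val_inj; rewrite /= mod0n.
    rewrite expgS IHk; congr (_, _).
      by rewrite /=; case: (odd k) => /=; rewrite ?mulg1 ?mulg_ffun2.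
    by apply: val_inj; rewrite /= modnDmr modnDml add1n.
  (* As n is odd, [i] and [i + n] agree modulo n but differ in parity; the one with parity [b] is
     taken. *)
  exists (if odd i == b then i : nat else (i + n)%N); rewrite powk.
  congr (_, _).
    by case: ifP => [/eqP->|]; rewrite ?oddD ?oddn; case: b; case: (odd i).
  apply: val_inj => /=; case: ifP => _; first by rewrite modn_small.
  by rewrite -[X in (_ + X) %% _](prednK n_gt0) modnDr modn_small.
have gen_pow v (i : Zmod n) b : gen [set ((v, inZp 1) : K)] (if b then v else 1, i).
  by have [k <-] := pow v i b; apply/gen1P; exists k, 0; rewrite expg0 invg1 mulg1.
case: x y => [v i] [w j] /= vw; apply/cyclic_pairP; case: vw => [->|->|->].
- by exists (w, inZp 1); split; [apply: (gen_pow _ _ false) | apply: (gen_pow _ _ true)].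
- by exists (v, inZp 1); split; [apply: (gen_pow _ _ true) | apply: (gen_pow _ _ false)].
by exists (w, inZp 1); split; apply: (gen_pow _ _ true).
Qed.

(** A nontrivial [x.1] would equal every basis vector [e j], and m > 1 provides two of them. *)
Lemma Cyc_Z2m_Zn x : Cyc K x <-> x.1 = 1.
Proof.
split=> [Cx|x1 y]; last by apply/cyclic_pair_Z2m_Zn; constructor 1.
pose e (j : 'I_m) : {ffun 'I_m -> Zmod 2} := [ffun i => if i == j then inZp 1 else 1].
have e_neq1 j : e j <> 1.
  by move/ffunP/(_ j); rewrite !ffunE eqxx => /(congr1 val).
have xe j : x.1 = 1 \/ x.1 = e j.
  by have /cyclic_pair_Z2m_Zn[|/e_neq1|] := Cx ((e j, 1) : K); [left | | right].
have m_gt0 := ltnW m_gt1.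
have [//|x0] := xe (Ordinal m_gt0); have [//|x1] := xe (Ordinal m_gt1).
move: x0; rewrite x1 => /ffunP/(_ (Ordinal m_gt0)).
by rewrite !ffunE => /(congr1 val).
Qed.

Lemma Z2m_Zn_not_Cyc : exists x, ~ Cyc K x.
Proof.
pose v : {ffun 'I_m -> Zmod 2} := [ffun=> inZp 1].
exists (v, 1) => /Cyc_Z2m_Zn /ffunP.
by move/(_ (Ordinal m_gt1)); rewrite !ffunE => /(congr1 val).
Qed.

End TwoTorsionByCyclic.

(** * Isomorphic groups have isomorphic graphs *)

Lemma group_iso_cyclic_pair (G K : groupType) (f : {multiplicative G -> K}) x y :
    bijective f ->
  cyclic_subgroup (gen [set f x; f y]) <-> cyclic_subgroup (gen [set x; y]).
Proof.
case=> g fK gK; split; last exact: multiplicative_cyclic_pair.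
have := @multiplicative_cyclic_pair _ _ (multiplicative_of_morph (can2_gmulfM fK gK)).
by move=> /(_ (f x) (f y)); rewrite /= !fK.
Qed.

Lemma group_iso_Cyc (G K : groupType) (f : {multiplicative G -> K}) x :
  bijective f -> Cyc K (f x) <-> Cyc G x.
Proof.
move=> fbij; have [g _ gK] := fbij; split=> C y.
  exact/(group_iso_cyclic_pair _ _ fbij).
by rewrite -[y]gK; apply/(group_iso_cyclic_pair _ _ fbij).
Qed.

Lemma group_iso_graph_iso (G K : groupType) :
  group_iso G K -> graph_iso (noncyclic_graph G) (noncyclic_graph K).
Proof.
case=> f fbij; have [g fK gK] := fbij.
have pairE x y := group_iso_cyclic_pair x y fbij.
have CycE x := group_iso_Cyc x fbij.
have fP (u : noncyclic_graph G) : f (val u) \in ~` Cyc K.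
  by have := set_valP u; rewrite inE /= => nC /CycE.
have gP (u : noncyclic_graph K) : g (val u) \in ~` Cyc G.
  by have := set_valP u; rewrite inE /= => nC /CycE; rewrite gK.
exists (fun u => SigSub (fP u)).
  exists (fun u => SigSub (gP u)) => u; apply: val_inj => /=; [exact: fK|exact: gK].
move=> u v; rewrite /= /noncyclic_adj /=; split=> -[uv Nuv]; split.
- by move/(congr1 val)/(can_inj fK)/val_inj.
- by move/pairE.
- by move=> eq_uv; apply: uv; rewrite eq_uv.
by move/pairE.
Qed.

(* A copy of [G] that carries the finite structure given by the list [s]. *)
Definition listed (G : groupType) (s : seq G) (sP : forall x, x \in s) : Type := G.

Section Listed.
Variables (G : groupType) (s : seq G) (sP : forall x, x \in s).

HB.instance Definition _ := Group.on (listed sP).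

Lemma listed_indexK : cancel (index^~ s : listed sP -> nat) (nth (1 : G) s).
Proof. by move=> x; rewrite nth_index. Qed.

HB.instance Definition _ := Choice_isCountable.Build (listed sP) (can_pcan listed_indexK).

Lemma listed_enumP : Finite.axiom (undup s : seq (listed sP)).
Proof. by move=> x; rewrite count_uniq_mem ?undup_uniq // mem_undup sP. Qed.

HB.instance Definition _ := isFinite.Build (listed sP) listed_enumP.

(** In a finite group the natural powers of [z] already include the inverses, so both notions of
    generated subgroup agree. *)
Lemma cyc2_listed (x y : listed sP) :
  cyc2 x y <-> cyclic_subgroup (gen [set (x : G); (y : G)]).
Proof.
split=> [/cyc2P[z [/cycleP[i xE] /cycleP[j yE]]]|].
  apply/cyclic_pairP; exists (z : G); split; apply/gen1P.
    by exists i, 0; rewrite expg0 invg1 mulg1.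
  by exists j, 0; rewrite expg0 invg1 mulg1.
case/cyclic_pairP=> z [/gen1P[i [j xE]] /gen1P[k [l yE]]].
apply/cyc2P; exists (z : listed sP); rewrite xE yE.
by rewrite !groupM ?groupV //; apply: mem_cycle.
Qed.

End Listed.

(** * Recovering the group from its graph *)

Lemma noncyclic_graph_iso_param (G : groupType) (m n : nat) :
    odd n -> 1 < m -> noncyclic_graph_iso G (Z2m_Zn m n) ->
  exists2 g : Z2m_Zn m n -> G, {morph g : x y / x * y} & bijective g.
Proof.
move=> oddn m_gt1 [_ _ [h [h' hK h'K] hadj]].
set K := Z2m_Zn m n in h h' hK h'K hadj *.
have VK (k : K) : k.1 != 1 -> k \in ~` Cyc K.
  by move=> k1; apply/mem_set => /(Cyc_Z2m_Zn oddn m_gt1)/eqP; apply/negP.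
have VK1 (u : noncyclic_graph K) : (val u).1 != 1.
  by apply/eqP => u1; apply: (set_valP u); apply/(Cyc_Z2m_Zn oddn m_gt1).
have n_gt0 := odd_gt0 oddn.
have [k0 /(@mem_set _ (~` Cyc K)) Vk0] := Z2m_Zn_not_Cyc oddn m_gt1.
have finV : finite_set (~` Cyc G).
  (* The inverse isomorphism, extended by 1 off the vertices, carries the finiteness of [K] to the
     vertices of [G]. *)
  pose r (k : K) : G := if insub k is Some u then val (h' u) else 1.
  apply: (@sub_finite_set _ _ (r @` [set: K])).
    move=> x Vx; exists (val (h (SigSub (mem_set Vx)))) => //.
    by rewrite /r valK hK.
  apply: finite_image; exact: (@finite_finset ({ffun 'I_m -> 'I_2} * 'I_n.-1.+1)%type).
have finG : finite_set [set: G].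
  by apply: finite_group_of_vertices finV; apply: (set_valP (h' (SigSub Vk0))).
have [s sE] := (finite_seqP _).1 finG.
have sP x : x \in s.
  have : [set: G] x by [].
  by rewrite sE.
(* A vertex is coloured by the (Z_2)^m component of its image. That component is never 1, so the
   default 1 marks exactly [Cyc G]. *)
pose col (x : listed sP) : {ffun 'I_m -> 'I_2} :=
  if insub (x : G) is Some u then (val (h u)).1 else 1.
have col_val u : col (val u) = (val (h u)).1 by rewrite /col valK.
have CycE (x : listed sP) : x \in cyclicizer (listed sP) <-> Cyc G x.
  split=> [/cyclicizerP Cx y|Cx].
    by apply/(cyc2_listed (sP := sP)).
  apply/cyclicizerP=> y; apply/cyc2_listed; exact: Cx.
have nCycE (x : listed sP) : x \notin cyclicizer (listed sP) ->
    exists u : noncyclic_graph G, val u = x.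
  move=> nCx; have Vx : x \in ~` Cyc G by apply/mem_set => /CycE; apply/negP.
  by exists (SigSub Vx).
have colC (x : listed sP) : (col x == 1) = (x \in cyclicizer (listed sP)).
  apply/eqP/idP => [colx|/CycE Cx].
    apply: contraT => /nCycE[u ux]; move: colx (VK1 (h u)).
    by rewrite -ux col_val => ->; rewrite eqxx.
  rewrite /col; case: insubP => // u _ ux; case: (set_valP u).
  by rewrite -ux in Cx.
have [|||g gM gbij] := @multipartite_param (listed sP) _ _ col n m colC _ _ oddn m_gt1.
- move=> x y /nCycE[u <-] /nCycE[v <-]; rewrite !col_val.
  apply/idP/eqP => [/cyc2_listed cuv|eq_uv].
    have [->//|/eqP uv] := eqVneq u v; apply: contrapT => col_uv.
    suff: adj u v by case.
    apply/hadj; split=> [/(congr1 val) huv|]; first by apply: col_uv; rewrite huv.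
    case/(cyclic_pair_Z2m_Zn oddn) => //; apply/eqP/VK1.
  apply/cyc2_listed; have [->|/eqP uv] := eqVneq u v; first exact: cyclic_pairxx.
  apply: contrapT => ncuv; have /hadj[_] : adj u v by split.
  by apply; apply/(cyclic_pair_Z2m_Zn oddn); constructor 3.
- move=> t t_neq1; rewrite cardsE.
  have Vt (i : Zmod n) : ((t, i) : K) \in ~` Cyc K by apply: VK.
  (* The elements [(t, i)], pulled back by [h'], enumerate the part of colour [t]. *)
  pose r i : listed sP := val (h' (SigSub (Vt i))).
  have r_inj : injective r.
    by move=> i j /val_inj/(can_inj h'K)/(congr1 val)[].
  rewrite -[RHS](prednK n_gt0) -[RHS]card_ord -(card_codom r_inj).
  apply: eq_card => x; rewrite unfold_in; apply/(col x =P t)/codomP => [colx|[i ->]].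
    have /nCycE[u ux] : x \notin cyclicizer (listed sP) by rewrite -colC colx.
    exists (val (h u)).2; rewrite -ux -{1}[u]hK /r; congr (val (h' _)).
    apply: val_inj; transitivity (t, (val (h u)).2) => //.
    by rewrite -colx -ux col_val; apply: surjective_pairing.
  by rewrite /r col_val h'K.
- by rewrite card_ffun !card_ord.
by exists g.
Qed.

Close Scope group_scope.

Theorem proposition7p7 (G : groupType) (n m : nat) (hn : 0 < n) (hodd : odd n)
    (hm : 1 < m) :
  noncyclic_graph_iso G (Z2m_Zn m n) <-> group_iso G (Z2m_Zn m n).
Proof.
split=> [graphGK|GK].
  have [g gM gbij] := noncyclic_graph_iso_param hodd hm graphGK.
  by apply: group_iso_sym; exists (multiplicative_of_morph gM).
have [x nCx] := Z2m_Zn_not_Cyc hodd hm; have [f fbij] := GK.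
have [g _ gK] := fbij.
split; [|exact: not_Cyc_not_locally_cyclic nCx|exact: group_iso_graph_iso].
(* The preimage of a vertex of the second graph witnesses that [G] is not locally cyclic. *)
apply: (@not_Cyc_not_locally_cyclic _ (g x)).
by rewrite -(group_iso_Cyc _ fbij) gK.
Qed.
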